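(* Let $m,k$ be integers with $1\le m$, $k\le N-1$, $k-m>1$, such that $$\phi^{m-1}-\phi^m>\phi^m-\phi^{m+1}=\phi^{m+1}-\phi^{m+2}=\cdots=\phi^{k-1}-\phi^k>\phi^k-\phi^{k+1}.$$ Then $\mathfrak{A}_{m+1}=\mathfrak{A}_{m+2}=\cdots=\mathfrak{A}_k$, $\aleph^\bullet_{m+1}=\aleph^\bullet_{m+2}=\cdots=\aleph^\bullet_k$, and for every ${\tt Y}\in\aleph_k$ $$\tilde{\cal F}^m|_{\uparrow{\tt Y}}\subseteq\tilde{\cal F}^{m+1}|_{\uparrow{\tt Y}}=\tilde{\cal F}^{m+2}|_{\uparrow{\tt Y}}=\cdots=\tilde{\cal F}^{k-1}|_{\uparrow{\tt Y}}\supseteq\tilde{\cal F}^k|_{\uparrow{\tt Y}}.$$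
   Context: $V$ is a directed graph without loops on a finite vertex set ${\tt N}$, $|{\tt N}|=N$; each arc $(i,j)$ has a real weight $v_{ij}$; $V$ is assumed to have at least one spanning tree. An (entering) forest is a directed graph in which at most one arc leaves each vertex and there are no directed cycles; its components are trees, the root of a tree being its unique vertex with no outgoing arc. All forests are subgraphs of $V$. $\Upsilon^G=\sum_{(i,j)\in G}v_{ij}$. ${\cal F}^j$: spanning forests of $V$ with exactly $j$ trees; $\phi^j=\min_{F\in{\cal F}^j}\Upsilon^F$ ($\phi^j=\infty$ if ${\cal F}^j=\emptyset$; $\phi^0=\infty$); $\tilde{\cal F}^j$: forests in ${\cal F}^j$ of weight $\phi^j$. $\mathfrak{A}_j$: algebra of subsets of ${\tt N}$ generated (under complements and intersections) by the vertex sets of all trees of all forests in $\tilde{\cal F}^j$; $\aleph_j$: its atoms (nonempty elements ${\tt A}$ with ${\tt A}\cap{\tt B}\in\{\emptyset,{\tt A}\}$ for all ${\tt B}\in\mathfrak{A}_j$); $\aleph_j^\bullet$: labeled atoms (containing a root of some tree of some $F\in\tilde{\cal F}^j$). For a graph $G$ and ${\tt D}\subseteq{\tt N}$, ${\tt N}^{out}_{\tt D}(G)$ is the set of heads $j\notin{\tt D}$ of arcs $(i,j)\in G$ with $i\in{\tt D}$, and the outgoing restriction $G|_{\uparrow{\tt D}}$ has as arcs exactly the arcs of $G$ with tail in ${\tt D}$ and vertex set ${\tt D}\cup{\tt N}^{out}_{\tt D}(G)$. For sets of forests ${\cal F},{\cal F}'$, ${\cal F}|_{\uparrow{\tt D}}\subseteq{\cal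 F}'|_{\uparrow{\tt D}}$ means: for every $F\in{\cal F}$ there is $F'\in{\cal F}'$ with $F|_{\uparrow{\tt D}}=F'|_{\uparrow{\tt D}}$; equality means inclusion in both directions. *)

(* Defs.v *)
From HB Require Import structures.
From mathcomp Require Import all_boot all_order all_algebra.
From mathcomp Require Import constructive_ereal reals.

Set Implicit Arguments.
Unset Strict Implicit.
Unset Printing Implicit Defensive.

Import Order.TTheory GRing.Theory Num.Theory.

Local Open Scope ring_scope.

(* A directed graph on the vertex set T is given by its set of arcs, and a    *)
(* spanning subgraph of V is a subset of V.                                   *)

Definition arc (T : finType) (G : {set T * T}) : rel T :=
  fun x y => (x, y) \in G.

Definition loopless (T : finType) (G : {set T * T}) : bool :=
  [forall x, ~~ arc G x x].

(* A directed cycle is a nonempty ucycle; its vertices being distinct, its    *)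
(* length is at most #|T|.                                                    *)
Definition acyclic (T : finType) (G : {set T * T}) : bool :=
  [forall n : 'I_#|T|, forall c : n.+1.-tuple T, ~~ ucycleb (arc G) c].

Definition is_forest (T : finType) (G : {set T * T}) : bool :=
  [forall x, (#|[set y | arc G x y]| <= 1)%N] && acyclic G.

Definition adj (T : finType) (G : {set T * T}) : rel T :=
  fun x y => arc G x y || arc G y x.

(* vertex sets of the (weakly) connected components *)
Definition trees (T : finType) (G : {set T * T}) : {set {set T}} :=
  equivalence_partition (connect (adj G)) [set: T].

Definition is_root (T : finType) (G : {set T * T}) (x : T) : bool :=
  [forall y, ~~ arc G x y].

Definition forests (T : finType) (V : {set T * T}) (j : nat) :
    {set {set T * T}} :=
  [set F : {set T * T} | [&& F \subset V, is_forest F & #|trees F| == j]].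

Definition weight (R : realType) (T : finType) (v : T -> T -> R)
    (G : {set T * T}) : R :=
  \sum_(a in G) v a.1 a.2.

Definition phi (R : realType) (T : finType) (V : {set T * T})
    (v : T -> T -> R) (j : nat) : \bar R :=
  \big[Order.min/+oo%E]_(F in forests V j) (weight v F)%:E.

Lemma phi0 (R : realType) (T : finType) (V : {set T * T}) (v : T -> T -> R) :
  (0 < #|T|)%N -> phi V v 0 = +oo%E.
Proof.
case/card_gt0P=> x _; rewrite /phi big_pred0 // => F.
apply/negbTE; rewrite inE !negb_and -lt0n card_gt0; apply/orP; right.
apply/orP; right; apply/set0Pn; eexists; apply: imset_f; exact: in_setT x.
Qed.

Definition min_forests (R : realType) (T : finType) (V : {set T * T})
    (v : T -> T -> R) (j : nat) : {set {set T * T}} :=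
  [set F in forests V j | (weight v F)%:E == phi V v j].

Definition is_algebra (T : finType) (S : {set {set T}}) : bool :=
  [&& [set: T] \in S,
      [forall A in S, ~: A \in S] &
      [forall A in S, forall B in S, A :&: B \in S]].

Definition generated_algebra (T : finType) (S : {set {set T}}) :
    {set {set T}} :=
  \bigcap_(A : {set {set T}} | is_algebra A && (S \subset A)) A.

Definition algebra (R : realType) (T : finType) (V : {set T * T})
    (v : T -> T -> R) (j : nat) : {set {set T}} :=
  generated_algebra (\bigcup_(F in min_forests V v j) trees F).

Definition atoms (R : realType) (T : finType) (V : {set T * T})
    (v : T -> T -> R) (j : nat) : {set {set T}} :=
  [set A in algebra V v j | (A != set0) &&
    [forall B in algebra V v j, (A :&: B == set0) || (A :&: B == A)]].

Definition labeled_atoms (R : realType) (T : finType) (V : {set T * T})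
    (v : T -> T -> R) (j : nat) : {set {set T}} :=
  [set A in atoms V v j |
    [exists F in min_forests V v j, exists x in A, is_root F x]].

Definition out_neighbours (T : finType) (D : {set T}) (G : {set T * T}) :
    {set T} :=
  [set y | (y \notin D) && [exists x in D, arc G x y]].

(* the pair (vertex set, arc set) *)
Definition out_restriction (T : finType) (D : {set T}) (G : {set T * T}) :
    {set T} * {set T * T} :=
  (D :|: out_neighbours D G, [set a in G | a.1 \in D]).

Definition out_sub (T : finType) (D : {set T}) (S S' : {set {set T * T}}) :
    Prop :=
  forall F, F \in S ->
    exists2 F', F' \in S' & out_restriction D F = out_restriction D F'.

Definition out_eq (T : finType) (D : {set T}) (S S' : {set {set T * T}}) :
    Prop :=
  out_sub D S S' /\ out_sub D S' S.

(* Main.v *)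
Require Import Defs.
From HB Require Import structures.
From mathcomp Require Import all_boot all_order all_algebra.
From mathcomp Require Import constructive_ereal reals.
From mathcomp Require Import zify ring lra.

Set Implicit Arguments.
Unset Strict Implicit.
Unset Printing Implicit Defensive.

Import Order.TTheory GRing.Theory Num.Theory.

Local Open Scope ring_scope.

(* If D is a union of trees of a forest F, then exchanging with any forest G  *)
(* the arcs leaving the vertices of D yields two forests, with the same total *)
(* weight and the same total number of roots.  Charging lam for each root, the*)
(* forests of minimal cost are therefore closed under such exchanges.         *)
(* Exchanges show that the root counts of the forests of minimal cost form an *)
(* interval, whence phi is convex, and for lam = phi m - phi m.+1 the minimal *)
(* forests with j roots, m <= j <= k, are exactly the optimal ones.           *)
(* Further exchanges, with a minimal forest with k roots or m roots, add or   *)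
(* remove one root: adding one can be done by cutting one tree in two; when   *)
(* there are at least m + 2 roots, one can be removed while keeping two given *)
(* vertices in distinct trees, or keeping a given root, or keeping the arcs   *)
(* leaving a given tree.                                                      *)

(* mathcomp's path.arc would otherwise hide the arc relation of a graph.      *)
Local Notation arc := Defs.arc.

(** By convexity of phi, minimal forests with m to k roots are the optimal ones for one price [lam]
    per root ([min_forests_optimal]), and [optimal_swap] lets any two of them exchange arcs along a
    union of trees of one. The algebra depends only on which pairs of vertices no minimal forest
    separates, and the labels then only on which vertices can be roots. Both data agree at levels j
    and j.+1 when m < j < k: [split_tree] refines a forest with j trees and keeps its roots, while
    [separate_down] and [drop_root] lead back from j.+1 >= m + 2 trees.

    An atom of level k lies in one tree of every minimal forest of levels m.+1 to k. A spare tree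
    elsewhere can then be dropped, or grafted from a forest with k trees by [add_root], without
    changing the arcs that leave the atom. *)

(** * Roots and trees of a forest, and exchange of arcs *)

Section ForestRoots.
Variable T : finType.
Implicit Types (F G H : {set T * T}) (D S : {set T}) (x y z r : T).

Definition roots F : {set T} := [set x | is_root F x].

Definition functional F := forall x y z, arc F x y -> arc F x z -> y = z.

(** A decreasing height stands in for acyclicity because the heights of two forests can be glued, as
    in [is_forest_swap]. *)
Definition ranked F (h : T -> nat) := forall x y, arc F x y -> (h y < h x)%N.

Lemma acyclic_connect F x y :
  acyclic F -> arc F x y -> connect (arc F) y x = false.
Proof.
move=> /forallP acF Fxy; apply/negbTE/negP => /connectP[p pth].
case/shortenP: pth => q pth uq _ lq.
have sq : (size q < #|T|)%N.
  by rewrite -[(size q).+1]/(size (y :: q)) -(card_uniqP uq) max_card.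
have /forallP/(_ (in_tuple (y :: q))) := acF (Ordinal sq).
by rewrite /ucycleb /= rcons_path pth -lq Fxy -[_ && _]/(uniq (y :: q)) uq.
Qed.

Lemma is_forest_functional F : is_forest F -> functional F.
Proof.
case/andP=> /forallP F1 _ x y z Fxy Fxz.
by apply: (card_le1_eqP (F1 x)); rewrite inE.
Qed.

(** The height counts reachable vertices: along an arc the tail is lost, being unreachable from the
    head. *)
Lemma is_forest_ranked F : is_forest F -> exists h, ranked F h.
Proof.
case/andP=> _ acF; exists (fun x => #|[set y | connect (arc F) x y]|).
move=> x y Fxy; apply: proper_card; apply/properP; split.
  apply/subsetP=> z; rewrite !inE; exact/connect_trans/connect1.
by exists x; rewrite inE ?connect0 ?(acyclic_connect acF Fxy).
Qed.

Lemma functional_ranked_forest F h : functional F -> ranked F h -> is_forest F.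
Proof.
move=> fF hF; apply/andP; split.
  apply/forallP=> x; apply/card_le1_eqP=> y z; rewrite !inE => Fxy Fxz.
  by rewrite (fF _ _ _ Fxy Fxz).
apply/forallP=> n; apply/forallP=> -[[|x p] //= sz]; apply/negP=> /andP[/= cyc _].
have tr : transitive (fun u v => h v < h u)%N by move=> a b c ab bc; exact: ltn_trans bc ab.
have : path (fun u v => h v < h u)%N x (rcons p x) by apply: sub_path cyc => u w /hF.
by move/(order_path_min tr)/allP/(_ x); rewrite mem_rcons mem_head ltnn => /(_ isT).
Qed.

Definition rt F x := odflt x [pick r | is_root F r && connect (arc F) x r].

Lemma connect_root_inj F x r r' : is_forest F -> is_root F r -> is_root F r' ->
  connect (arc F) x r -> connect (arc F) x r' -> r = r'.
Proof.
move=> /is_forest_functional fF Fr Fr' /connectP[p pth er].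
elim: p x pth er Fr => [|y p IH] x /=.
  move=> _ -> Fx /connectP[[|z q] //=] /andP[Fxz _] _.
  by move/forallP/(_ z): Fx; rewrite Fxz.
move=> /andP[Fxy pth] er Fr /connectP[[|z q] /=].
  by move=> _ eqx; move/forallP/(_ y): Fr'; rewrite eqx Fxy.
move=> /andP[Fxz pz] lz; apply: (IH y) => //.
by rewrite (fF _ _ _ Fxy Fxz); apply/connectP; exists q.
Qed.

Lemma rtP F x : is_forest F -> is_root F (rt F x) && connect (arc F) x (rt F x).
Proof.
move=> fF; suff [r Fr xr] : exists2 r, is_root F r & connect (arc F) x r.
  by rewrite /rt; case: pickP => [//|/(_ r)]; rewrite Fr xr.
have [h hF] := is_forest_ranked fF.
have [n le_n] := ubnP (h x); elim: n => // n IH in x le_n *.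
case Fx: (is_root F x); first by exists x; rewrite ?connect0.
move/negbT: Fx; rewrite negb_forall => /existsP[y]; rewrite negbK => Fxy.
have [|r Fr yr] := IH y; first exact: leq_trans (hF _ _ Fxy) le_n.
by exists r => //; exact: connect_trans (connect1 Fxy) yr.
Qed.

Lemma rt_root F x : is_forest F -> is_root F (rt F x).
Proof. by move/(rtP x)/andP => -[]. Qed.

Lemma rt_connect F x : is_forest F -> connect (arc F) x (rt F x).
Proof. by move/(rtP x)/andP => -[]. Qed.

Lemma rt_id F x : is_forest F -> is_root F x -> rt F x = x.
Proof.
move=> fF Fx; apply: (connect_root_inj fF (rt_root x fF) Fx (rt_connect x fF)).
exact: connect0.
Qed.

Lemma rt_arc F x y : is_forest F -> arc F x y -> rt F y = rt F x.
Proof.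
move=> fF Fxy; apply: (connect_root_inj (x := x) fF); try exact: rt_root.
  exact: connect_trans (connect1 Fxy) (rt_connect y fF).
exact: rt_connect.
Qed.

Definition tree F x : {set T} := [set y | rt F y == rt F x].

Lemma connect_ind F (P : T -> T -> Prop) :
  (forall x, P x x) -> (forall x y z, arc F x y -> P y z -> P x z) ->
  forall x y, connect (arc F) x y -> P x y.
Proof.
move=> P0 P1 x _ /connectP[p pth ->].
elim: p x pth => [|y p IH] x //= /andP[Fxy /IH]; exact: P1 Fxy.
Qed.

Lemma rt_stable F S x : is_forest F ->
  (forall u w, arc F u w -> u \in S -> w \in S) -> x \in S -> rt F x \in S.
Proof.
move=> fF cS; move: (rt_connect x fF).
by elim/(connect_ind (F := F)) => // {}x y z Fxy IH /(cS _ _ Fxy).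
Qed.

(** The path from [x] to its [F]-root stays in [S], where [G] has the same arcs. *)
Lemma rt_agree F G S x : is_forest F -> is_forest G ->
  (forall u w, arc F u w -> u \in S -> w \in S) ->
  (forall u w, u \in S -> arc G u w = arc F u w) ->
  x \in S -> rt G x = rt F x.
Proof.
move=> fF fG cS eqS xS.
have: is_root G (rt F x).
  have /forallP Fr := rt_root x fF.
  by apply/forallP=> y; rewrite eqS ?Fr // rt_stable.
move=> /(rt_id fG) <-; move: (rt_connect x fF) xS.
elim/(connect_ind (F := F)) => // {}x y z Fxy IH xS.
by rewrite -IH ?(cS _ _ Fxy) // (@rt_arc G x y) ?eqS.
Qed.

Lemma rt_morph F (A : Type) (f : T -> A) x : is_forest F ->
  (forall u w, arc F u w -> f w = f u) -> f (rt F x) = f x.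
Proof.
move=> fF cf; move: (rt_connect x fF).
by elim/(connect_ind (F := F)) => // {}x y z Fxy ->; exact: cf.
Qed.

(** Arcs preserve the root, hence so do undirected paths; conversely, two vertices meet at their
    common root. *)
Lemma connect_adj F x y : is_forest F -> connect (adj F) x y = (rt F x == rt F y).
Proof.
move=> fF; have symF : connect_sym (adj F).
  by apply: sym_connect_sym => u w; rewrite /adj orbC.
have xrt u : connect (adj F) u (rt F u).
  by apply: connect_sub (rt_connect u fF) => a b Fab; rewrite connect1 // /adj Fab.
apply/idP/eqP=> [/connectP[p pth ->]|eqxy].
  elim: p x pth => [|z p IH] x //= /andP[/orP[]Fxz /IH <-]; last exact: rt_arc.
  by rewrite (rt_arc fF Fxz).
by apply: connect_trans (xrt x) _; rewrite eqxy symF.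
Qed.

Lemma treesE F : is_forest F -> trees F = [set tree F x | x in roots F].
Proof.
move=> fF; apply/setP=> A; apply/imsetP/imsetP => -[x xP ->].
  exists (rt F x); first by rewrite inE rt_root.
  by apply/setP=> y; rewrite !inE connect_adj // (rt_id fF (rt_root x fF)) eq_sym.
by exists x => //; apply/setP=> y; rewrite !inE connect_adj // eq_sym.
Qed.

Lemma mem_trees F x : is_forest F -> tree F x \in trees F.
Proof.
move=> fF; rewrite treesE //; apply/imsetP; exists (rt F x); first by rewrite inE rt_root.
by apply/setP=> y; rewrite !inE (rt_id fF (rt_root x fF)).
Qed.

Lemma card_trees F : is_forest F -> #|trees F| = #|roots F|.
Proof.
move=> fF; rewrite treesE // card_in_imset // => x y; rewrite !inE => Fx Fy /setP/(_ x).
by rewrite !inE eqxx !rt_id // => /esym/eqP.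
Qed.

Lemma ltn_card_roots F : is_forest F -> (0 < #|T|)%N -> (0 < #|roots F|)%N.
Proof.
by move=> fF /card_gt0P[x _]; apply/card_gt0P; exists (rt F x); rewrite inE rt_root.
Qed.

Definition swap D F G : {set T * T} :=
  [set a in F | a.1 \in D] :|: [set a in G | a.1 \notin D].

Lemma arc_swap D F G x y :
  arc (swap D F G) x y = if x \in D then arc F x y else arc G x y.
Proof. by rewrite /arc !inE /=; case: (x \in D); rewrite ?andbT ?andbF ?orbF. Qed.

Lemma is_root_swap D F G x :
  is_root (swap D F G) x = if x \in D then is_root F x else is_root G x.
Proof.
rewrite /is_root; under eq_forallb => y do rewrite arc_swap.
by case: (x \in D).
Qed.

Lemma roots_swap D F G : roots (swap D F G) = (roots F :&: D) :|: (roots G :\: D).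
Proof.
apply/setP=> x; rewrite !inE is_root_swap.
by case: (x \in D); rewrite ?andbT ?andbF ?orbF.
Qed.

(** For a forest [F], this makes [D] a union of trees. *)
Definition saturated F D := forall x y, arc F x y -> (x \in D) = (y \in D).

Lemma saturatedC F D : saturated F D -> saturated F (~: D).
Proof. by move=> sF x y /sF; rewrite !inE => ->. Qed.

Lemma saturated_tree F x : is_forest F -> saturated F (tree F x).
Proof. by move=> fF u w /(rt_arc fF); rewrite !inE => ->. Qed.

(** Arcs of [G] may enter [D], but no arc leaves it again, so no cycle crosses its boundary. *)
Lemma is_forest_swap D F G : is_forest F -> is_forest G -> saturated F D ->
  is_forest (swap D F G).
Proof.
move=> fF fG sF; have [h hF] := is_forest_ranked fF; have [l lG] := is_forest_ranked fG.
(* [M] lifts all heights outside [D] above those inside. *)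
pose M := \max_x h x.
apply: (@functional_ranked_forest _ (fun x => if x \in D then h x else (M + (l x).+1)%N)).
  move=> x y z; rewrite !arc_swap; case: ifP => _; exact: is_forest_functional.
move=> x y; rewrite arc_swap; case: ifPn => [xD Fxy|xD Gxy].
  by rewrite -(sF _ _ Fxy) xD hF.
case: ifP => _; last by rewrite ltn_add2l ltnS lG.
by rewrite addnS ltnS (leq_trans (leq_bigmax (F := h) y)) ?leq_addr.
Qed.

Lemma swap_sub (V : {set T * T}) D F G : F \subset V -> G \subset V -> swap D F G \subset V.
Proof.
move=> FV GV; apply/subsetP=> a; rewrite !inE.
by case/orP=> /andP[aF _]; [exact: (subsetP FV _ aF)|exact: (subsetP GV _ aF)].
Qed.

End ForestRoots.

(** * Forests of minimal cost and their exchanges *)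

Section Optimal.
Variables (R : realType) (T : finType) (V : {set T * T}) (v : T -> T -> R).
Implicit Types (F G H P : {set T * T}) (D : {set T}) (x y : T) (lam : R).

Definition forest F := (F \subset V) && is_forest F.

(** [lam] is a Lagrange multiplier for the number of roots. *)
Definition cost lam F := weight v F + lam * #|roots F|%:R.

Definition optimal lam F :=
  forest F /\ forall G, forest G -> cost lam F <= cost lam G.

Lemma optimal_forest lam F : optimal lam F -> is_forest F.
Proof. by case=> /andP[]. Qed.

Lemma weight_swap D F G :
  weight v (swap D F G) + weight v (swap (~: D) F G) = weight v F + weight v G.
Proof.
have split1 (E : {set T}) A B : weight v (swap E A B) =
    \sum_(a in A | a.1 \in E) v a.1 a.2 + \sum_(a in B | a.1 \notin E) v a.1 a.2.
  rewrite /weight (bigID (fun a => a.1 \in E)) /=; congr (_ + _); apply: eq_bigl => a;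
  by rewrite !inE; case: (a.1 \in E); rewrite ?andbT ?andbF ?orbF.
have split2 A : weight v A =
    \sum_(a in A | a.1 \in D) v a.1 a.2 + \sum_(a in A | a.1 \notin D) v a.1 a.2.
  by rewrite /weight (bigID (fun a => a.1 \in D)).
have cpl (A : {set T * T}) : \sum_(a in A | a.1 \in ~: D) v a.1 a.2 =
    \sum_(a in A | a.1 \notin D) v a.1 a.2.
  by apply: eq_bigl => a; rewrite !inE.
have cplN (A : {set T * T}) : \sum_(a in A | a.1 \notin ~: D) v a.1 a.2 =
    \sum_(a in A | a.1 \in D) v a.1 a.2.
  by apply: eq_bigl => a; rewrite !inE negbK.
by rewrite !split1 cpl cplN (split2 F) (split2 G); ring.
Qed.

Lemma card_roots_swap D F G :
  (#|roots (swap D F G)| + #|roots (swap (~: D) F G)| = #|roots F| + #|roots G|)%N.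
Proof.
have eU (E A B : {set T}) : #|(A :&: E) :|: (B :\: E)| = (#|A :&: E| + #|B :\: E|)%N.
  rewrite cardsU (_ : A :&: E :&: (B :\: E) = set0) ?cards0 ?subn0 //.
  by apply/setP=> x; rewrite !inE; case: (x \in E); rewrite ?andbF.
rewrite !roots_swap !eU -[roots F :&: ~: D]setDE [roots G :\: ~: D]setDE setCK.
by rewrite -(cardsID D (roots F)) -(cardsID D (roots G)); lia.
Qed.

Lemma cost_swap lam D F G :
  cost lam (swap D F G) + cost lam (swap (~: D) F G) = cost lam F + cost lam G.
Proof.
by rewrite /cost addrACA weight_swap -mulrDr -natrD card_roots_swap natrD mulrDr addrACA.
Qed.

(** Both exchanges are forests, and their costs add up to twice the minimum, so each attains it. *)
Lemma optimal_swap lam D F G : optimal lam F -> optimal lam G -> saturated F D ->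
  optimal lam (swap D F G).
Proof.
move=> [/andP[FV fF] minF] [/andP[GV fG] minG] sF.
have ok E : saturated F E -> forest (swap E F G).
  by move=> sE; rewrite /forest swap_sub // is_forest_swap.
split=> [|H fH]; first exact: ok.
have := lerD (minF _ fH) (minG _ (ok _ (saturatedC sF))).
by rewrite -(cost_swap lam D F G) lerD2r.
Qed.

(** The [G]-tree of [g] holds no root of [P]; given the arcs of [P], its vertices all drain into
    other trees. *)
Lemma drop_root lam G P g : optimal lam G -> optimal lam P -> is_root G g ->
    (forall p, is_root P p -> rt G p <> g) ->
  exists H, [/\ optimal lam H, roots H = roots G :\ g
    & forall x, rt G x <> g ->
        rt H x = rt G x /\ forall y, arc H x y = arc G x y].
Proof.
move=> oG oP Gg noP; have fG := optimal_forest oG; have fP := optimal_forest oP.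
set D := tree G g; have sD : saturated G D by exact: saturated_tree.
exists (swap (~: D) G P).
have oH : optimal lam (swap (~: D) G P) by apply: optimal_swap => //; exact: saturatedC.
have inD x : (x \in D) = (rt G x == g) by rewrite inE (rt_id fG Gg).
split=> // [|x /eqP xg].
  apply/setP=> x; rewrite roots_swap !inE (rt_id fG Gg).
  case Gx: (is_root G x); case Px: (is_root P x);
    rewrite ?andbF ?andbT ?orbF ?(rt_id fG Gx) //=.
    by have /eqP := noP x Px; rewrite (rt_id fG Gx) => /negPf ->.
  by apply/negbTE/negP=> /negbNE/eqP; exact: noP.
have agree u w : u \in ~: D -> arc (swap (~: D) G P) u w = arc G u w.
  by move=> uD; rewrite arc_swap uD.
have xD : x \in ~: D by rewrite inE inD.
split; last by move=> y; exact: agree.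
apply: (rt_agree fG (optimal_forest oH) _ agree xD).
by move=> u w /(saturatedC sD) ->.
Qed.

(** The [F]-tree of [f] is grafted onto [G]; as it holds no root of [G], none is lost. *)
Lemma add_root lam F G f : optimal lam F -> optimal lam G -> is_root F f ->
    (forall g, is_root G g -> rt F g <> f) ->
  exists H, [/\ optimal lam H, roots H = f |: roots G
    & forall x y, rt F x <> f -> arc H x y = arc G x y].
Proof.
move=> oF oG Ff noG; have fF := optimal_forest oF.
set D := tree F f; have sD : saturated F D by exact: saturated_tree.
have inD x : (x \in D) = (rt F x == f) by rewrite inE (rt_id fF Ff).
exists (swap D F G); split; first exact: optimal_swap.
  apply/setP=> x; rewrite roots_swap in_setU in_setI in_setD in_setU1 inD !inE.
  case Fx: (is_root F x); rewrite ?(rt_id fF Fx) /=.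
    by case: eqVneq => //= ->; rewrite orbT.
  have /negPf -> : x != f by apply: contraFneq Fx => ->.
  case Gx: (is_root G x); rewrite ?andbF //= andbT.
  by have /eqP := noG x Gx => ->.
by move=> x y /eqP xf; rewrite arc_swap inD (negPf xf).
Qed.

(* Two roots of F lie in one G-tree D.  With F1 equal to F on D and to G       *)
(* elsewhere, one of the F1-trees E inside D avoids the G-root of D, and E     *)
(* can be cut from D.                                                          *)
Lemma split_tree lam F G : optimal lam F -> optimal lam G ->
    (#|roots G| < #|roots F|)%N ->
  exists f H, [/\ optimal lam H, f \notin roots G, roots H = f |: roots G
    & forall x y, rt H x = rt H y -> rt G x = rt G y].
Proof.
move=> oF oG ltGF; have fG := optimal_forest oG; have fF := optimal_forest oF.
have [f1 Ff1 [f2 Ff2 [neqf eqf]]] : exists2 f1, is_root F f1 & exists2 f2,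
    is_root F f2 & f1 <> f2 /\ rt G f1 = rt G f2.
  (* Pigeonhole: [rt G] maps the roots of [F] into the smaller set of roots of [G]. *)
  have /dinjectivePn[f1] : ~~ dinjectiveb (rt G) (mem (roots F)).
    apply/dinjectiveP=> /card_in_imset; apply/eqP; rewrite ltn_eqF //.
    apply: leq_ltn_trans ltGF; apply: subset_leq_card; apply/subsetP=> _ /imsetP[x _ ->].
    by rewrite inE rt_root.
  rewrite inE => Ff1 [f2 /andP[neq]]; rewrite inE => Ff2 eqf.
  by exists f1 => //; exists f2 => //; split=> // e; rewrite e eqxx in neq.
set g := rt G f1; have Gg : is_root G g by exact: rt_root.
set D := tree G f1; have sD : saturated G D by exact: saturated_tree.
pose F1 := swap (~: D) G F.
have oF1 : optimal lam F1 by apply: optimal_swap => //; exact: saturatedC.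
have fF1 := optimal_forest oF1.
have inD x : (x \in D) = (rt G x == g) by rewrite inE.
have F1r f : is_root F f -> f \in D -> is_root F1 f.
  by move=> Ff fD; rewrite is_root_swap in_setC fD.
(* At most one of [f1], [f2] is the [F1]-root of [g]; the other one serves. *)
have [f [Ff fD F1f gf]] : exists f, [/\ is_root F f, f \in D, is_root F1 f & rt F1 g <> f].
  have D1 : f1 \in D by rewrite inD.
  have D2 : f2 \in D by rewrite inD -eqf.
  case: (eqVneq (rt F1 g) f1) => [e|/eqP ne]; last by exists f1; split=> //; exact: F1r.
  by exists f2; split=> //; [exact: F1r|rewrite e].
set E := tree F1 f; have inE1 x : (x \in E) = (rt F1 x == f) by rewrite inE (rt_id fF1 F1f).
have sE : saturated F1 E by exact: saturated_tree.
have ED x : x \in E -> x \in D.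
  rewrite inE1; apply: contraTT; rewrite -in_setC => xD.
  have : rt F1 x \in ~: D.
    apply: rt_stable xD => // u w; rewrite arc_swap => uw uD.
    by rewrite uD in uw; rewrite -(saturatedC sD uw).
  by rewrite inE; apply: contra => /eqP ->.
pose H := swap E F1 G.
have oH : optimal lam H by exact: optimal_swap.
have fH := optimal_forest oH.
have fG' : ~~ is_root G f.
  apply/negP=> Gf; move: fD; rewrite inD (rt_id fG Gf) => /eqP e.
  by apply: gf; rewrite -e; exact: rt_id.
exists f, H; split=> //; first by rewrite inE.
  apply/setP=> x; rewrite roots_swap in_setU in_setI in_setD in_setU1 inE1 !inE.
  case F1x: (is_root F1 x); rewrite ?(rt_id fF1 F1x) /=.
    by case: eqVneq => //= ->; rewrite orbT.
  have /negPf -> /= : x != f by apply: contraFneq F1x => ->.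
  case Gx: (is_root G x); rewrite ?andbF //= andbT.
  apply/negP=> /[dup] /eqP xf; rewrite -inE1 => /ED; rewrite inD (rt_id fG Gx) => /eqP xg.
  by rewrite xg in xf.
(* No arc of [H] passes from one [G]-tree to another, so the trees of [H] refine those of [G]. *)
have cst u w : arc H u w -> rt G w = rt G u.
  rewrite arc_swap; case: ifPn => [uE uw|_]; last exact: rt_arc.
  have wE : w \in E by rewrite -(sE _ _ uw).
  by move/ED: uE; move/ED: wE; rewrite !inD => /eqP -> /eqP ->.
move=> x y eqH.
by rewrite -(rt_morph x fH cst) eqH (rt_morph y fH cst).
Qed.

Lemma optimal_between lam F G c : optimal lam F -> optimal lam G ->
    (#|roots F| <= c <= #|roots G|)%N ->
  exists2 H, optimal lam H & #|roots H| = c.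
Proof.
move=> oF oG; elim: c => [|c IH] /andP[leFc lecG].
  by exists F => //; apply/eqP; rewrite -leqn0.
case: (ltngtP #|roots F| c.+1) leFc => // [ltFc _|eqFc _]; last by exists F.
have [|H oH cH] := IH; first by rewrite -ltnS ltFc ltnW.
have [|f [K [oK fH rK _]]] := split_tree oG oH; first by rewrite cH.
by exists K; rewrite // rK cardsU1 fH cH.
Qed.

(* Take a chord straddling c of minimal height at c, and lam such that both of *)
(* its endpoints have the same cost: no forest with a number of roots other    *)
(* than c is below this chord, so if none with c roots is, then both endpoints *)
(* are optimal and optimal_between applies.                                    *)
Lemma weight_roots_convex F G c : forest F -> forest G ->
    (#|roots F| < c < #|roots G|)%N ->
  exists H, [/\ forest H, #|roots H| = c &
    (#|roots G| - #|roots F|)%:R * weight v H <=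
      (#|roots G| - c)%:R * weight v F + (c - #|roots F|)%:R * weight v G].
Proof.
move=> fF fG cFG.
pose ok (p : {set T * T} * {set T * T}) :=
  [&& forest p.1, forest p.2 & (#|roots p.1| < c < #|roots p.2|)%N].
pose chord (p : {set T * T} * {set T * T}) : R :=
  ((#|roots p.2|%:R - c%:R) * weight v p.1 + (c%:R - #|roots p.1|%:R) * weight v p.2)
  / (#|roots p.2|%:R - #|roots p.1|%:R).
have okFG : ok (F, G) by rewrite /ok /= fF fG.
have := @arg_minP _ _ _ (F, G) ok chord okFG.
case: arg_minP => //= -[A B] /and3P[/= fA fB /andP[ltAc ltcB]] minAB _.
set a := #|roots A| in ltAc; set b := #|roots B| in ltcB.
pose lam := (weight v A - weight v B) / (b%:R - a%:R).
have ac : a%:R < c%:R :> R by rewrite ltr_nat.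
have cb : c%:R < b%:R :> R by rewrite ltr_nat.
have ab : b%:R - a%:R != 0 :> R by rewrite subr_eq0 gt_eqF // (lt_trans ac).
have eqw : weight v A - weight v B = lam * (b%:R - a%:R) by rewrite /lam divfK.
have eqAB : cost lam A = cost lam B by rewrite /cost -/a -/b; lra.
have chordAB : chord (A, B) = cost lam A - lam * c%:R.
  rewrite /chord /cost /= -/a -/b; apply: (canLR (mulfK ab)).
  have -> : weight v B = weight v A - lam * (b%:R - a%:R) by rewrite -eqw; ring.
  ring.
have chordFG : chord (A, B) <= chord (F, G) by exact: minAB.
(* An [H] below the chord could replace the endpoint on its side of [c] and lower the height at
   [c]. *)
have low H : forest H -> #|roots H| != c -> cost lam A <= cost lam H.
  move=> fH; rewrite neq_ltn => /orP[ltHc|ltcH].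
    have hc : #|roots H|%:R < c%:R :> R by rewrite ltr_nat.
    have := minAB (H, B); rewrite /ok /= fH fB ltHc ltcB => /(_ isT).
    rewrite chordAB /chord /= -/b ler_pdivlMr; last lra.
    rewrite /cost in eqAB *; rewrite -/a -/b in eqAB *.
    set h := _%:R in hc *; set wH := weight v H.
    move: (weight v A) (weight v B) eqAB => wA wB eqAB le.
    have e : wA = wB + lam * b%:R - lam * a%:R by lra.
    rewrite -(ler_pM2l (x := b%:R - c%:R)); last lra.
    rewrite e in le *; lra.
  have hc : c%:R < #|roots H|%:R :> R by rewrite ltr_nat.
  have := minAB (A, H); rewrite /ok /= fA fH ltAc ltcH => /(_ isT).
  rewrite chordAB /chord /= -/a ler_pdivlMr; last lra.
  rewrite /cost -/a.
  set h := _%:R in hc *; set wH := weight v H; set wA := weight v A => le.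
  rewrite -(ler_pM2l (x := c%:R - a%:R)); last lra.
  lra.
case: (pickP (fun H => [&& forest H, #|roots H| == c & cost lam H <= cost lam A])).
  move=> H /and3P[fH /eqP cH leH]; exists H; split=> //.
  have fc : #|roots F|%:R < c%:R :> R by case/andP: cFG; rewrite ltr_nat.
  have cg : c%:R < #|roots G|%:R :> R by case/andP: cFG; rewrite ltr_nat.
  have [/ltnW/natrB fcB /ltnW/natrB cgB] := andP cFG.
  rewrite fcB cgB natrB; last by case/andP: cFG => /ltnW ? /ltnW; exact: leq_trans.
  rewrite mulrC -ler_pdivlMr; last lra.
  apply: le_trans chordFG; rewrite chordAB; move: leH; rewrite {1}/cost cH; lra.
move=> noH; have oA : optimal lam A.
  split=> // H fH; case: (eqVneq #|roots H| c) => [cH|]; last exact: low.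
  by have := noH H; rewrite fH cH eqxx /= => /negbT; rewrite -ltNge => /ltW.
have oB : optimal lam B by split=> // H fH; rewrite -eqAB; case: oA => _; apply.
have [|H [fH minH] cH] := @optimal_between lam A B c oA oB.
  by rewrite (ltnW ltAc) (ltnW ltcB).
by have := noH H; rewrite fH cH eqxx minH.
Qed.

(* P1 is P on the G-tree D of x, and G elsewhere.  Exchanging P1 and G on the  *)
(* P1-tree E of y preserves the G-tree of y but expels p from that of x.       *)
Lemma reroute lam G P x y p q : optimal lam G -> optimal lam P ->
    rt G x <> rt G y -> (forall r, is_root P r -> rt G r <> rt G x) ->
    arc P p q -> rt G p = rt G x -> rt G q <> rt G x -> rt G q <> rt G y ->
  exists H, [/\ optimal lam H, rt H x <> rt H y, rt H y = rt G y &
    roots H = roots G :\ rt G x \/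
    [/\ roots H = roots G, forall u, rt H u = rt G y -> rt G u = rt G y &
      forall u, rt H u = rt G x -> rt G u = rt G x /\ u <> p]].
Proof.
move=> oG oP xy noP Ppq px qx qy.
have fG := optimal_forest oG; have fP := optimal_forest oP.
set D := tree G x; have sD : saturated G D by exact: saturated_tree.
have inD u : (u \in D) = (rt G u == rt G x) by rewrite inE.
pose P1 := swap (~: D) G P.
have oP1 : optimal lam P1 by apply: optimal_swap => //; exact: saturatedC.
have fP1 := optimal_forest oP1.
have P1G u w : u \in ~: D -> arc P1 u w = arc G u w by move=> uD; rewrite arc_swap uD.
have rtP1 u : u \in ~: D -> rt P1 u = rt G u.
  by apply: (rt_agree fG fP1 _ P1G) => a b /(saturatedC sD) ->.
have yD : y \in ~: D by rewrite inE inD; apply/eqP => /esym.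
set E := tree P1 y.
have inE1 u : (u \in E) = (rt P1 u == rt G y) by rewrite inE (rtP1 y).
have sE : saturated P1 E by exact: saturated_tree.
pose H := swap (~: E) P1 G.
have oH : optimal lam H by apply: optimal_swap => //; exact: saturatedC.
have fH := optimal_forest oH.
have yE u : rt G u = rt G y -> u \in E.
  by move=> uy; rewrite inE1 rtP1 ?uy ?eqxx // inE inD uy; apply/eqP=> /esym.
have HG u w : u \in E -> arc H u w = arc G u w by move=> uE; rewrite arc_swap inE uE.
have HP1 u w : u \notin E -> arc H u w = arc P1 u w by move=> uE; rewrite arc_swap inE uE.
have HO u w : rt G u <> rt G x -> arc H u w = arc G u w.
  move=> ux; case: (boolP (u \in E)) => [|uE]; first exact: HG.
  by rewrite HP1 // P1G // inE inD; apply/eqP.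
have rtHO u : rt G u <> rt G x -> rt H u = rt G u.
  move=> ux; apply: (@rt_agree _ G H [set z | rt G z == rt G u]) => //.
  - by move=> a b /(rt_arc fG); rewrite !inE => ->.
  - by move=> a b; rewrite inE => /eqP au; rewrite HO // au.
  - by rewrite inE.
(* Outside [E], arcs of [H] stay outside [E], which contains the [G]-tree of [y]; inside [E] they
   are arcs of [G] and stay in their [G]-tree. *)
have noty u : rt G u <> rt G y -> rt H u <> rt G y.
  move=> uy; have : rt H u \in [set z | rt G z != rt G y].
    apply: rt_stable => //; last by rewrite inE; apply/eqP.
    move=> a b; rewrite !inE; case: (boolP (a \in E)) => aE.
      by rewrite HG // => /(rt_arc fG) ->.
    rewrite HP1 // => /sE ab _; rewrite ab in aE.
    by apply: contra aE => /eqP; exact: yE.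
  by rewrite inE => /eqP h e; apply: h; rewrite e (rt_id fG (rt_root y fG)).
have xx : rt G (rt G x) = rt G x by exact: (rt_id fG (rt_root x fG)).
exists H; split=> //; first by rewrite (rtHO y); [exact: noty|exact/nesym].
  by apply: rtHO; exact/nesym.
(* Only the root of the tree of [x] can be lost: off [E], that tree carries the arcs of [P], which
   has no root there. *)
have root_out u : is_root H u = if u == rt G x then u \in E else is_root G u.
  rewrite is_root_swap in_setC; case: (boolP (u \in E)) => uE /=.
    by case: eqP => // ->; rewrite rt_root.
  rewrite is_root_swap in_setC inD.
  case: (eqVneq u (rt G x)) => [->|ux].
    rewrite xx eqxx /=; apply/negbTE/negP => /noP; exact.
  case: eqP => //= uDx; case Pu: (is_root P u); first by have := noP _ Pu uDx.
  by apply/esym/negbTE; apply: contra ux => /(rt_id fG) <-; exact/eqP.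
case: (boolP (rt G x \in E)) => xE; [right|left]; last first.
  by apply/setP=> u; rewrite !inE root_out; case: eqP => [->|]; rewrite ?(negPf xE).
split=> [|u uy|u ux].
- by apply/setP=> u; rewrite !inE root_out; case: eqP => // ->; rewrite xE rt_root.
- by case: (eqVneq (rt G u) (rt G y)) => // /eqP /noty; rewrite uy.
have Gu : rt G u = rt G x.
  by case: (eqVneq (rt G u) (rt G x)) => // /eqP un; have := un; rewrite -(rtHO u un) ux.
split=> // e; subst u.
(* The arc from [p] to [q] leads [P1] to a root other than that of [y], so [H] keeps this arc. *)
have pE : p \notin E.
  rewrite inE1 -(rt_arc (y := q) fP1) ?rtP1; first exact/eqP.
    by rewrite inE inD; exact/eqP.
  by rewrite arc_swap in_setC inD px eqxx.
have Hpq : arc H p q by rewrite HP1 // arc_swap in_setC inD px eqxx.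
by rewrite -(rt_arc fH Hpq) rtHO in ux.
Qed.

(* If every G-tree other than those of x and y contains a root of P, then by   *)
(* counting these two contain none; rerouting shrinks them until a root is     *)
(* removed, or the tree of the former root of x can be dropped.                *)
Lemma separate_down lam G P x y : optimal lam G -> optimal lam P ->
    (#|roots P| + 2 <= #|roots G|)%N -> rt G x <> rt G y ->
  exists H, [/\ optimal lam H, (#|roots H|).+1 = #|roots G| & rt H x <> rt H y].
Proof.
move=> oG oP lePG.
have [n le_n] := ubnP (#|tree G x| + #|tree G y|)%N.
elim: n => // n IH in x y G oG lePG le_n * => xy.
have fG := optimal_forest oG; have fP := optimal_forest oP.
have dropG H a b g : optimal lam H -> roots H = roots G -> rt H a <> rt H b ->
    is_root H g -> g <> rt H a -> g <> rt H b ->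
    (forall p, is_root P p -> rt H p <> g) ->
    exists K, [/\ optimal lam K, (#|roots K|).+1 = #|roots G| & rt K a <> rt K b].
  move=> oH rH sH Hg ga gb noP; have [K [oK rK agree]] := drop_root oH oP Hg noP.
  exists K; split=> //; last by rewrite (agree a (nesym ga)).1 (agree b (nesym gb)).1.
  by rewrite -rH rK (cardsD1 g (roots H)) inE Hg.
case: (pickP (fun g => [&& is_root G g, g != rt G x, g != rt G y &
    [forall p, is_root P p ==> (rt G p != g)]])) => [g|allP].
  move=> /and4P[Gg /eqP gx /eqP gy /forallP noP]; apply: (dropG G x y g) => // p Pp.
  by apply/eqP; move: (noP p); rewrite Pp.
(* Otherwise the roots of [P] other than [r], fewer than #|roots G| - 2, would have to meet all the
   #|roots G| - 2 remaining trees. *)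
have noP r : is_root P r -> rt G r <> rt G x /\ rt G r <> rt G y.
  move=> Pr; suff : (rt G r != rt G x) && (rt G r != rt G y) by case/andP=> /eqP ? /eqP.
  rewrite -negb_or; apply/negP=> rxy.
  have : roots G :\ rt G x :\ rt G y \subset rt G @: (roots P :\ r).
    apply/subsetP=> g; rewrite !inE => /and3P[gy gx Gg].
    have := allP g; rewrite Gg gx gy /= => /negbT; rewrite negb_forall => /existsP[p].
    rewrite negb_imply negbK => /andP[Pp /eqP pg]; apply/imsetP; exists p => //.
    rewrite !inE Pp andbT; apply: contraTneq rxy => <-.
    by rewrite pg negb_or gx.
  move/subset_leq_card/leq_trans/(_ (leq_imset_card _ _)).
  have := cardsD1 (rt G x) (roots G); have := cardsD1 (rt G y) (roots G :\ rt G x).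
  have := cardsD1 r (roots P); rewrite !inE !rt_root // Pr.
  have -> : rt G y != rt G x by apply/eqP=> /esym.
  by move: lePG => /=; lia.
have [h hP] := is_forest_ranked fP.
(* [p] is lowest for [P] within the two trees and is no root of [P], so its [P]-arc leaves both. *)
have [p pxy minp] := @arg_minnP _ x (fun u => (rt G u == rt G x) || (rt G u == rt G y)) h
  (introT orP (or_introl (eqxx _))).
have [q Ppq [qx qy]] : exists2 q, arc P p q & rt G q <> rt G x /\ rt G q <> rt G y.
  have : ~~ is_root P p by apply/negP => /noP[p1 p2]; case/orP: pxy => /eqP.
  rewrite negb_forall => /existsP[q]; rewrite negbK => Ppq; exists q => //.
  by split=> e; have := minp q; rewrite e eqxx ?orbT leqNgt (hP _ _ Ppq) => /(_ isT).
clear minp allP; wlog px : x y xy le_n noP qx qy pxy / rt G p = rt G x.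
  move=> W; case/orP: (pxy) => /eqP px; first exact: (W x y).
  have [||||||H [oH cH sH]] := W y x (nesym xy); rewrite 1?addnC 1?orbC //.
    by move=> r /noP[].
  by exists H; split=> //; exact/nesym.
have [|H [oH sH Hy rH]] := @reroute lam G P x y p q oG oP xy _ Ppq px qx qy.
  by move=> r /noP[].
case: rH => [rH|[rH Hy' Hx]].
  by exists H; split=> //; rewrite rH (cardsD1 (rt G x) (roots G)) inE rt_root.
case: (eqVneq (rt H x) (rt G x)) => [xH|/eqP xH].
  have [|||K [oK cK sK]] := IH x y H oH; rewrite ?rH //; last by exists K; rewrite -rH.
  rewrite -ltnS (leq_trans _ le_n) // !ltnS -addSn leq_add //.
    apply: proper_card; apply/properP; split.
      by apply/subsetP=> u; rewrite !inE xH => /eqP /Hx[-> _].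
    by exists p; rewrite !inE ?px // xH; apply/eqP => /Hx[].
  by apply/subset_leq_card/subsetP=> u; rewrite !inE Hy => /eqP /Hy' ->.
apply: (dropG H x y (rt G x)) => //; last by move=> r /noP[nx _] /Hx[].
- by have : rt G x \in roots G by [rewrite inE rt_root]; rewrite -rH inE.
- exact/nesym.
- by rewrite Hy.
Qed.

End Optimal.

(** * Generated algebras as unions of cells *)

Section GeneratedAlgebra.
Variable T : finType.
Implicit Types (S : {set {set T}}) (A : {set T}).

(** The sets not splitting a given pair form an algebra. Conversely, [A] is the union of the cells
    of its points, a cell being an intersection of members of [S] and complements of members. *)
Lemma mem_generated_algebra S A :
  A \in generated_algebra S <->
  forall x y, (forall B, B \in S -> (x \in B) = (y \in B)) -> (x \in A) = (y \in A).
Proof.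
split=> [/bigcapP genA x y Sxy|satA].
  have := genA [set B : {set T} | (x \in B) == (y \in B)]; rewrite inE => /(_ _)/eqP; apply.
  apply/andP; split; last by apply/subsetP=> B /Sxy; rewrite inE => ->.
  apply/and3P; split.
  - by rewrite !inE.
  - by apply/forall_inP=> B; rewrite !inE => /eqP ->.
  - apply/forall_inP=> B; rewrite inE => /eqP Bxy; apply/forall_inP=> C.
    by rewrite !inE Bxy => /eqP ->.
apply/bigcapP=> X /andP[/and3P[XT /forall_inP XC /forall_inP XI] /subsetP SX].
have X0 : set0 \in X by rewrite -setCT XC.
have XI2 B C : B \in X -> C \in X -> B :&: C \in X by move=> /XI /forall_inP XB; exact: XB.
have XU B C : B \in X -> C \in X -> B :|: C \in X.
  by move=> XB XC'; rewrite -[_ :|: _]setCK setCU XC // XI2 ?XC.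
have -> : A = \bigcup_(x in A) \bigcap_(B in S) (if x \in B then B else ~: B).
  apply/setP=> y; apply/idP/bigcupP => [yA|[x xA /bigcapP xy]].
    exists y => //; apply/bigcapP=> B _.
    by case: (boolP (y \in B)) => // yB; rewrite inE.
  rewrite -(satA x) // => B /xy.
  by case: (boolP (x \in B)) => xB; rewrite ?inE; [move=> ->|move/negPf=> ->].
apply: (big_ind (fun B => B \in X)) => // x _.
apply: (big_ind (fun B => B \in X)) => // B /SX XB.
by case: ifP => _ //; exact: XC.
Qed.

End GeneratedAlgebra.

(** * Minimal forests as optimal forests *)

Section MinForests.
Variables (R : realType) (T : finType) (V : {set T * T}) (v : T -> T -> R).
Implicit Types (F G H P : {set T * T}) (D Y : {set T}) (x y : T) (lam : R).
Local Notation optimal := (optimal V v).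
Local Notation forest := (forest V).
Local Notation cost := (cost v).

Lemma mem_forests F j : F \in forests V j <-> forest F /\ #|roots F| = j.
Proof.
rewrite inE /forest; split=> [/and3P[-> fF /eqP <-]|[/andP[-> fF] <-]].
  by rewrite fF card_trees.
by rewrite fF card_trees /=.
Qed.

Lemma phi_min j F : F \in forests V j ->
    (forall G, G \in forests V j -> weight v F <= weight v G) ->
  phi V v j = (weight v F)%:E.
Proof.
move=> Fj minF; apply/le_anti; rewrite bigmin_le_cond //=.
by apply: le_bigmin => [|G /minF]; rewrite ?leey ?lee_fin.
Qed.

Lemma min_forestsP j F : F \in min_forests V v j <->
  F \in forests V j /\ forall G, G \in forests V j -> weight v F <= weight v G.
Proof.
rewrite [F \in min_forests _ _ _]inE; split=> [/andP[Fj /eqP eqF]|[Fj minF]].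
  by split=> // G Gj; rewrite -lee_fin eqF; apply: bigmin_le_cond.
by rewrite Fj (phi_min Fj minF) eqxx.
Qed.

Lemma min_forests_neq0 j : forests V j != set0 -> exists F, F \in min_forests V v j.
Proof.
case/set0Pn=> F0 F0j; case: (arg_minP (weight v) F0j) => F Fj minF.
by exists F; apply/min_forestsP.
Qed.

(** Deleting the arc that leaves a non-root adds one tree. *)
Lemma forests_neq0 j : forests V 1 != set0 -> (1 <= j <= #|T|)%N ->
  forests V j != set0.
Proof.
move=> F1; elim: j => // -[//|j] IH /andP[_ ltjT].
have /set0Pn[F /mem_forests[/andP[FV fF] cF]] := IH (ltnW ltjT).
have [x Fx] : exists x, ~~ is_root F x.
  apply/existsP; rewrite -negb_forall; apply/negP=> /forallP allr.
  have : roots F = [set: T] by apply/setP=> x; rewrite !inE allr.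
  by move=> eqT; move: ltjT; rewrite -cF eqT cardsT ltnn.
have no0 u w : arc set0 u w = false by rewrite /arc inE.
have f0 : is_forest (set0 : {set T * T}).
  by apply: (@functional_ranked_forest _ _ (fun=> 0%N)) => [u w z|u w]; rewrite no0.
have fH : is_forest (swap [set x] set0 F).
  by apply: is_forest_swap => // u w; rewrite no0.
apply/set0Pn; exists (swap [set x] set0 F); apply/mem_forests.
split; first by rewrite /forest swap_sub // sub0set.
have -> : roots (swap [set x] set0 F) = x |: roots F.
  apply/setP=> u; rewrite !inE is_root_swap !inE; case: eqP => //= _.
  by apply/forallP=> w; rewrite no0.
by rewrite cardsU1 inE Fx cF.
Qed.

(** A counting argument that supplies the root required by [drop_root] or [add_root], away from the
    forbidden set [A]. *)
Lemma free_root F G (A : {set T}) : is_forest F ->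
    (#|roots G| + #|A| < #|roots F|)%N ->
  exists2 f, is_root F f & f \notin A /\ forall g, is_root G g -> rt F g <> f.
Proof.
move=> fF ltGF; have : ~~ (roots F \subset A :|: rt F @: roots G).
  apply/negP=> /subset_leq_card; apply/negP; rewrite -ltnNge; apply: leq_ltn_trans ltGF.
  by rewrite cardsU addnC (leq_trans (leq_subr _ _)) // leq_add2r leq_imset_card.
case/subsetPn=> f; rewrite !inE negb_or => Ff /andP[fA nf].
exists f => //; split=> // g Gg gf.
by move/negP: nf; apply; rewrite -gf; apply: imset_f; rewrite inE.
Qed.

Lemma out_restriction_eq Y F G :
  (forall x y, x \in Y -> arc F x y = arc G x y) ->
  out_restriction Y F = out_restriction Y G.
Proof.
move=> eqFG; congr (_ :|: _, _).
  apply/setP=> y; rewrite !inE; congr (_ && _).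
  by apply: eq_existsb => x; case: (boolP (x \in Y)) => //= /eqFG; rewrite /arc => ->.
apply/setP=> -[x y]; rewrite !inE /=.
by case: (boolP (x \in Y)) => [/(eqFG x y)|]; rewrite ?andbF // /arc => ->.
Qed.

Lemma out_sub_trans Y (S1 S2 S3 : {set {set T * T}}) :
  out_sub Y S1 S2 -> out_sub Y S2 S3 -> out_sub Y S1 S3.
Proof.
by move=> s12 s23 F /s12[G /s23[H HS3 eqH] eqG]; exists H; rewrite // eqG.
Qed.

(** On [m, k] the equal differences put phi on a line of slope [- lam]; by convexity no forest lies
    below this line. *)
Lemma min_forests_optimal (m k : nat) :
    forests V 1 != set0 -> (1 <= m)%N -> (m < k)%N -> (k <= #|T|)%N ->
    (forall j : nat, (m <= j)%N -> (j < k)%N ->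
      (phi V v j - phi V v j.+1 = phi V v m - phi V v m.+1)%E) ->
  exists lam, forall j F, (m <= j <= k)%N ->
    F \in min_forests V v j <-> optimal lam F /\ #|roots F| = j.
Proof.
move=> V1 m1 mk kT eqphi.
have minF j : (1 <= j <= #|T|)%N -> exists F, F \in min_forests V v j.
  by move=> jT; apply/min_forests_neq0/forests_neq0.
pose W j := fine (phi V v j).
have phiW j : (1 <= j <= #|T|)%N -> phi V v j = (W j)%:E.
  by move/minF=> [F]; rewrite inE => /andP[_ /eqP e]; rewrite /W -e.
have WF j F : F \in min_forests V v j -> weight v F = W j.
  by rewrite inE => /andP[_ /eqP e]; rewrite /W -e.
have leW j F : forest F -> #|roots F| = j -> (1 <= j <= #|T|)%N -> W j <= weight v F.
  move=> fF cF /minF[G /[dup] /WF <- /min_forestsP[_]]; apply; exact/mem_forests.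
pose lam := W m - W m.+1.
have stepW j : (m <= j)%N -> (j < k)%N -> W j - W j.+1 = lam.
  move=> mj jk; have := eqphi j mj jk; rewrite !phiW; try lia.
  by rewrite -!EFinB => -[].
have linW j : (m <= j)%N -> (j <= k)%N -> W j + lam * j%:R = W m + lam * m%:R.
  elim: j => [|j IH]; first by rewrite leqn0 => /eqP ->.
  rewrite leq_eqVlt => /predU1P[->//|mj] jk.
  by rewrite -(IH mj (ltnW jk)) -(stepW j mj jk) -natr1; ring.
have T0 : (0 < #|T|)%N by lia.
have costW F : forest F -> W m + lam * m%:R <= cost lam F.
  move=> fF; have [FV fF'] := andP fF; have F0 := ltn_card_roots fF' T0.
  have FT : (#|roots F| <= #|T|)%N by exact: max_card.
  have W1 : W m.+1 = W m - lam by rewrite /lam; ring.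
  (* With fewer than m roots, the chord from [F] to level m.+1 is read at m; with more than m.+1,
     the chord from level m to [F] is read at m.+1. *)
  rewrite /cost; case: (ltngtP #|roots F| m) => [ltFm|ltmF|eqF].
  - have [|G Gm] := minF m.+1; first by lia.
    have /min_forestsP[/mem_forests[fG cG] _] := Gm.
    have := @weight_roots_convex R T V v F G m fF fG; rewrite cG ltFm ltnSn.
    case=> // H [fH cH]; rewrite (WF _ _ Gm) W1 !natrB; try lia.
    have := leW m H fH cH; rewrite m1 (ltnW (leq_trans mk kT)) => /(_ isT).
    rewrite -natr1; set f := #|roots F|%:R; set n := m%:R => leH.
    have fn : f <= n by rewrite ler_nat ltnW.
    have : (n + 1 - f) * W m <= (n + 1 - f) * weight v H by apply: ler_wpM2l => //; lra.
    by lra.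
  - have [|G Gm] := minF m; first by lia.
    have /min_forestsP[/mem_forests[fG cG] _] := Gm.
    case: (ltngtP #|roots F| m.+1) => [|lt1F|eqF]; first by lia.
      have := @weight_roots_convex R T V v G F m.+1 fG fF; rewrite cG lt1F ltnSn.
      case=> // H [fH cH]; rewrite (WF _ _ Gm) !natrB; try lia.
      have := leW m.+1 H fH cH; rewrite (leq_trans mk kT) W1 => /(_ isT).
      rewrite -natr1; set f := #|roots F|%:R; set n := m%:R => leH.
      have fn : n + 1 <= f by rewrite natr1 ler_nat ltnW.
      have : (f - n) * (W m - lam) <= (f - n) * weight v H by apply: ler_wpM2l => //; lra.
      by lra.
    have := leW _ F fF eqF; rewrite (leq_trans mk kT) W1 eqF -natr1 => /(_ isT).
    by lra.
  - have := leW _ F fF eqF; rewrite m1 (ltnW (leq_trans mk kT)) eqF => /(_ isT).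
    by lra.
exists lam => j F /andP[mj jk]; split=> [Fj|[[fF minF'] cF]].
  have /min_forestsP[/mem_forests[fF cF] _] := Fj; split=> //; split=> // G fG.
  by rewrite {1}/cost (WF _ _ Fj) cF linW //; exact: costW.
have [|G Gj] := minF j; first by lia.
have /min_forestsP[/mem_forests[fG cG] lowG] := Gj.
apply/min_forestsP; split; first exact/mem_forests.
move=> H Hj; apply: le_trans (lowG H Hj).
by have := minF' G fG; rewrite /cost cF cG lerD2r.
Qed.

End MinForests.

(** * Passing between consecutive levels *)

Section Levels.
Variables (R : realType) (T : finType) (V : {set T * T}) (v : T -> T -> R).
Variables (lam : R) (m k : nat).
Implicit Types (F G H P : {set T * T}) (D Y : {set T}) (x y : T).
Local Notation optimal := (optimal V v lam).
Local Notation min_forests := (min_forests V v).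

Hypothesis min_forestsE : forall j F, (m <= j <= k)%N ->
  F \in min_forests j <-> optimal F /\ #|roots F| = j.
Hypothesis ex_optimal_m : exists2 P, optimal P & #|roots P| = m.
Hypothesis ex_optimal_k : exists2 F, optimal F & #|roots F| = k.

Lemma min_forest j F : F \in min_forests j -> is_forest F.
Proof. by case/min_forestsP=> /mem_forests[/andP[]]. Qed.

Definition inseparable j x y := forall F, F \in min_forests j -> rt F x = rt F y.

Definition rootable j x := exists2 F, F \in min_forests j & is_root F x.

(** Equality of algebras thus reduces to equality of the relations [inseparable]. *)
Lemma mem_algebra j (A : {set T}) : A \in algebra V v j <->
  forall x y, inseparable j x y -> (x \in A) = (y \in A).
Proof.
rewrite mem_generated_algebra; split=> satA x y sep; apply: satA.
  move=> B /bigcupP[F Fj]; rewrite (treesE (min_forest Fj)) => /imsetP[z _ ->].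
  by rewrite !inE (sep F Fj).
move=> F Fj; apply/eqP; have fF := min_forest Fj.
have : tree F y \in \bigcup_(F in min_forests j) trees F.
  by apply/bigcupP; exists F => //; exact: mem_trees.
by move/sep; rewrite !inE eqxx.
Qed.

Lemma refine_min j G : (m <= j < k)%N -> G \in min_forests j ->
  exists2 H, H \in min_forests j.+1 & roots G \subset roots H /\
    forall x y, rt H x = rt H y -> rt G x = rt G y.
Proof.
move=> /andP[mj jk] Gj; have [|oG cG] := (min_forestsE G _).1 Gj; first by lia.
have [F oF cF] := ex_optimal_k.
have [|f [H [oH fG rH refH]]] := split_tree oF oG; first by rewrite cF cG.
exists H; first by apply/min_forestsE; [lia|split=> //]; rewrite rH cardsU1 fG cG.
by split=> //; rewrite rH subsetUr.
Qed.

(** Levels start at m.+1 because the steps down used below start from at least m + 2 roots. *)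
Lemma level_ind (Q : nat -> Prop) :
  (forall j, (m < j < k)%N -> Q j -> Q j.+1) ->
  (forall j, (m < j < k)%N -> Q j.+1 -> Q j) ->
  forall j, (m.+1 <= j <= k)%N -> Q j <-> Q m.+1.
Proof.
move=> up down; elim=> // j IH; rewrite ltnS => /andP[].
rewrite leq_eqVlt => /predU1P[-> //|mj jk].
have mjk : (m < j < k)%N by rewrite mj.
rewrite -IH; last by rewrite mj ltnW.
by split; [exact: down|exact: up].
Qed.

(** A separating forest of level j.+1 gives one of level j by [separate_down]; one of level j is
    refined into one of level j.+1. *)
Lemma inseparable_level j x y : (m.+1 <= j <= k)%N ->
  inseparable j x y <-> inseparable m.+1 x y.
Proof.
move=> mjk; apply: (@level_ind (fun j => inseparable j x y) _ _ j mjk) => {mjk}j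
  /andP[mj jk] sep G Gj.
  have [|oG cG] := (min_forestsE (j := j.+1) G _).1 Gj; first by lia.
  have [P oP cP] := ex_optimal_m.
  case: (eqVneq (rt G x) (rt G y)) => // /eqP sG.
  have [|H [oH cH sH]] := separate_down oG oP _ sG; first by rewrite cP cG addn2.
  case: sH; apply: sep; apply/min_forestsE; first by lia.
  by split=> //; apply/eqP; rewrite -eqSS cH cG.
have [|H Hj [_ refH]] := refine_min _ Gj; first by rewrite jk ltnW.
by apply/refH/sep.
Qed.

(** Refinement keeps roots. Downwards, m + 2 roots suffice to find one other than [x] whose tree
    holds no root of [P]. *)
Lemma rootable_level j x : (m.+1 <= j <= k)%N -> rootable j x <-> rootable m.+1 x.
Proof.
move=> mjk; apply: (@level_ind (fun j => rootable j x) _ _ j mjk) => {mjk}j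
  /andP[mj jk] [G Gj Gx].
  have [|H Hj [/subsetP rH _]] := refine_min _ Gj; first by rewrite jk ltnW.
  by exists H => //; have := rH x; rewrite !inE; apply.
have [|oG cG] := (min_forestsE (j := j.+1) G _).1 Gj; first by lia.
have [P oP cP] := ex_optimal_m; have fG := optimal_forest oG.
have [|g Gg [xg noP]] := @free_root T G P [set x] fG.
  by rewrite cP cG cards1 addn1.
have [H [oH rH _]] := drop_root oG oP Gg noP.
exists H; last first.
  have : x \in roots H by rewrite rH !inE Gx eq_sym -in_set1 xg.
  by rewrite inE.
apply/min_forestsE; first by lia.
split=> //; rewrite rH; have := cardsD1 g (roots G); rewrite cG inE Gg.
by rewrite add1n => -[].
Qed.

Lemma algebra_level j : (m.+1 <= j <= k)%N -> algebra V v j = algebra V v m.+1.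
Proof.
move=> mjk; apply/setP=> A; apply/idP/idP => /mem_algebra satA; apply/mem_algebra => x y;
  by move/(inseparable_level _ _ mjk); exact: satA.
Qed.

Lemma labeled_atoms_level j : (m.+1 <= j <= k)%N ->
  labeled_atoms V v j = labeled_atoms V v m.+1.
Proof.
move=> mjk; rewrite /labeled_atoms /atoms algebra_level //; apply/setP=> A; rewrite !inE.
congr (_ && _); apply/exists_inP/exists_inP => -[F Fj /exists_inP[x xA Fx]].
  have [|G Gj Gx] := (rootable_level x mjk).1; first by exists F.
  by exists G => //; apply/exists_inP; exists x.
have [|G Gj Gx] := (rootable_level x mjk).2; first by exists F.
by exists G => //; apply/exists_inP; exists x.
Qed.

(** The [F]-tree of [x] is in the algebra, so an atom meeting it lies inside it. *)
Lemma atom_inseparable j Y x y : Y \in atoms V v j -> x \in Y -> y \in Y ->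
  inseparable j x y.
Proof.
rewrite inE => /and3P[_ _ /forall_inP atY] xY yY F Fj.
have fF := min_forest Fj.
have /atY/orP[/eqP/setP/(_ x)|/eqP/setP/(_ y)] : tree F x \in algebra V v j.
- by apply/mem_algebra => a b /(_ F Fj); rewrite !inE => ->.
- by rewrite !inE xY eqxx.
- by rewrite !inE yY => /eqP.
Qed.

Lemma out_sub_down Y j : (m < j < k)%N ->
    (forall x y, x \in Y -> y \in Y -> inseparable j.+1 x y) ->
  out_sub Y (min_forests j.+1) (min_forests j).
Proof.
move=> /andP[mj jk] insY G Gj.
have [|oG cG] := (min_forestsE (j := j.+1) G _).1 Gj; first by lia.
have [P oP cP] := ex_optimal_m; have fG := optimal_forest oG.
have [|g Gg [Yg noP]] := @free_root T G P (rt G @: Y) fG.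
  rewrite cP cG; apply: leq_ltn_trans (_ : (m + 1 < j.+1)%N); last by rewrite addn1.
  rewrite leq_add2l; apply/card_le1_eqP=> _ _ /imsetP[x xY ->] /imsetP[y yY ->].
  exact: insY Gj.
have [H [oH rH agree]] := drop_root oG oP Gg noP; exists H.
  apply/min_forestsE; first by lia.
  split=> //; rewrite rH; have := cardsD1 g (roots G); rewrite cG inE Gg.
  by rewrite add1n => -[].
apply: out_restriction_eq => x y xY; rewrite (agree x _).2 // => e.
by move/negP: Yg; apply; rewrite -e imset_f.
Qed.

(** Since j.+1 < k, some tree of [F] holds neither a root of [G] nor a vertex of [Y]; it is grafted
    onto [G]. *)
Lemma out_sub_up Y j : (m <= j)%N -> (j.+1 < k)%N ->
    (forall x y, x \in Y -> y \in Y -> inseparable k x y) ->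
  out_sub Y (min_forests j) (min_forests j.+1).
Proof.
move=> mj jk insY G Gj; have [|oG cG] := (min_forestsE G _).1 Gj; first by lia.
have [F oF cF] := ex_optimal_k; have fF := optimal_forest oF.
have Fk : F \in min_forests k by apply/min_forestsE; rewrite ?leqnn ?andbT //; lia.
have [|f Ff [Yf noG]] := @free_root T F G (rt F @: Y) fF.
  rewrite cG cF; apply: leq_ltn_trans jk; rewrite -addn1 leq_add2l.
  apply/card_le1_eqP=> _ _ /imsetP[x xY ->] /imsetP[y yY ->].
  exact: insY Fk.
have [H [oH rH agree]] := add_root oF oG Ff noG; exists H.
  apply/min_forestsE; first by lia.
  split=> //; rewrite rH cardsU1 cG inE (_ : is_root G f = false) //.
  by apply/negP=> /noG; rewrite (rt_id fF).
apply: out_restriction_eq => x y xY; rewrite agree // => e.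
by move/negP: Yf; apply; rewrite -e imset_f.
Qed.

Lemma atom_level Y j x y : (m.+1 <= j <= k)%N -> Y \in atoms V v k ->
  x \in Y -> y \in Y -> inseparable j x y.
Proof.
move=> mjk Yk xY yY; have mkk : (m.+1 <= k <= k)%N.
  by case/andP: mjk => mj jk; rewrite leqnn (leq_trans mj jk).
apply/(inseparable_level x y mjk)/(inseparable_level x y mkk).
exact: atom_inseparable Yk xY yY.
Qed.

Lemma out_eq_level Y j : Y \in atoms V v k -> (m.+1 <= j <= k.-1)%N ->
  out_eq Y (min_forests j) (min_forests m.+1).
Proof.
move=> Yk; elim: j => // j IH; rewrite ltnS leq_eqVlt => /andP[/predU1P[<- _|mj jk]].
  by split=> F Fm; exists F.
have [|down up] := IH; first by rewrite mj ltnW.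
have jk' : (j.+1 < k)%N by lia.
split; last first.
  apply: out_sub_trans up _; apply: out_sub_up => //; first exact: ltnW.
  by move=> x y; apply: atom_level => //; lia.
apply: out_sub_trans down; apply: out_sub_down; first by rewrite mj ltnW.
by move=> x y; apply: atom_level => //; lia.
Qed.

End Levels.

Theorem theorem8 (R : realType) (T : finType) (V : {set T * T})
    (v : T -> T -> R) (m k : nat) :
  loopless V ->
  forests V 1 != set0 ->
  (1 <= m)%N -> (k <= #|T| - 1)%N -> (1 < k - m)%N ->
  (phi V v m - phi V v m.+1 < phi V v m.-1 - phi V v m)%E ->
  (forall j : nat, (m <= j)%N -> (j < k)%N ->
     (phi V v j - phi V v j.+1 = phi V v m - phi V v m.+1)%E) ->
  (phi V v k - phi V v k.+1 < phi V v k.-1 - phi V v k)%E ->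
  [/\ forall j : nat, (m.+1 <= j <= k)%N -> algebra V v j = algebra V v m.+1,
      forall j : nat, (m.+1 <= j <= k)%N ->
        labeled_atoms V v j = labeled_atoms V v m.+1
    & forall Y : {set T}, Y \in atoms V v k ->
      [/\ out_sub Y (min_forests V v m) (min_forests V v m.+1),
          forall j : nat, (m.+1 <= j <= k.-1)%N ->
            out_eq Y (min_forests V v j) (min_forests V v m.+1)
        & out_sub Y (min_forests V v k) (min_forests V v k.-1)]].
Proof.
move=> _ V1 m1 kT mk _ eqphi _.
have [|| lam minE] := min_forests_optimal V1 m1 _ _ eqphi; [lia|lia|].
have ex j : (m <= j <= k)%N -> exists2 F, optimal V v lam F & #|roots F| = j.
  move=> mjk; have [|F Fj] := @min_forests_neq0 R T V v j.
    by apply: forests_neq0 => //; lia.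
  by exists F; have /minE[] := Fj.
have Pm : exists2 P, optimal V v lam P & #|roots P| = m by apply: ex; lia.
have Fk : exists2 F, optimal V v lam F & #|roots F| = k by apply: ex; lia.
split=> [j|j|Y Yk].
- exact: algebra_level minE Pm Fk _.
- exact: labeled_atoms_level minE Pm Fk _.
have insY j x y : (m.+1 <= j <= k)%N -> x \in Y -> y \in Y -> inseparable V v j x y.
  by move=> mjk; exact: atom_level minE Pm Fk _ _ _ _ mjk Yk.
split=> [|j mjk|].
- apply: (out_sub_up minE Fk) => // [|x y]; first lia.
  by apply: insY; lia.
- exact: out_eq_level minE Pm Fk _ _ Yk mjk.
have -> : k = k.-1.+1 by lia.
apply: (out_sub_down minE Pm); first lia.
by move=> x y; apply: insY; lia.
Qed.
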